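(* Let $f \in L^1(\mathbb{R},\mathrm{Leb})$ be a real-valued function satisfying the following two assumptions: (1) $f_{k_0} \in L^\infty(\mathbb{R},\mathrm{Leb})$ for some $k_0\in\mathbb{N}$; (2) $\int_\mathbb{R} |x|^\epsilon |f(x)| \, \mathrm{d} x < \infty$ for some $\epsilon > 0$. Then there exists $k_1 \in \mathbb{N}$ such that for every $k\ge k_1$ the function $x \mapsto (1+|x|^\epsilon) f_k(x)$ is bounded, continuous and directly Riemann integrable. In particular, $f_k$ itself is bounded, continuous and directly Riemann integrable for every $k\ge k_1$.
   Context: For $f\in L^1(\mathbb{R})$, the convolution powers are defined by $f_1 := f$ and $f_{k+1}(x) := (f_k * f)(x) = \int_\mathbb{R} f_k(x-y) f(y)\,\mathrm{d}y$ for $k\in\mathbb{N}$. A non-negative function $g:\mathbb{R}\to[0,\infty)$ is called directly Riemann integrable (d.R.i.) if $$\lim_{\delta\downarrow 0}\sum_{m\in\mathbb{Z}}\delta\Big(\sup_{z\in[m\delta,(m+1)\delta)} g(z)\Big)=\lim_{\delta\downarrow 0}\sum_{m\in\mathbb{Z}}\delta\Big(\inf_{z\in[m\delta,(m+1)\delta)} g(z)\Big)\in(-\infty,\infty),$$ i.e. both limits exist, are finite and coincide. A real-valued function $g$ is d.R.i. if both its positive part $g^+$ and negative part $g^-$ are d.R.i. *)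

(* Defs.v *)
From HB Require Import structures.
From mathcomp Require Import all_boot all_order all_algebra.
From mathcomp Require Import all_classical all_reals all_analysis.
Set Implicit Arguments. Unset Strict Implicit. Unset Printing Implicit Defensive.
Import Order.TTheory GRing.Theory Num.Theory numFieldNormedType.Exports.
Local Open Scope classical_set_scope.
Local Open Scope ring_scope.

Definition conv (R : realType) (g h : R -> R) : R -> R :=
  fun x => Rintegral (@lebesgue_measure R) setT (fun y => g (x - y) * h y).

(* convolution powers, paper's indexing: conv_pow f 1 = f_1 = f,
   conv_pow f k.+1 = f_(k+1) = f_k * f for k >= 1; conv_pow f 0 := f (unused) *)
Fixpoint conv_pow (R : realType) (f : R -> R) (k : nat) : R -> R :=
  match k with
  | 0 => f
  | 1 => f
  | k'.+1 => conv (conv_pow f k') f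
  end.

Definition upper_sum (R : realType) (g : R -> R) (d : R) : \bar R :=
  (\esum_(m in [set: int])
     (d%:E * ereal_sup [set (g z)%:E | z in `[(m%:~R * d)%R, ((m%:~R + 1) * d)%R[]))%E.
Definition lower_sum (R : realType) (g : R -> R) (d : R) : \bar R :=
  (\esum_(m in [set: int])
     (d%:E * ereal_inf [set (g z)%:E | z in `[(m%:~R * d)%R, ((m%:~R + 1) * d)%R[]))%E.

Definition dRi_nonneg (R : realType) (g : R -> R) : Prop :=
  exists l : R, upper_sum g d @[d --> 0^'+] --> l%:E /\
                lower_sum g d @[d --> 0^'+] --> l%:E.

Definition dRi (R : realType) (g : R -> R) : Prop :=
  dRi_nonneg (fun x => Num.max (g x) 0) /\ dRi_nonneg (fun x => Num.max (- g x) 0).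

(* Main.v *)
Require Import Defs.
From HB Require Import structures.
From mathcomp Require Import all_boot all_order all_algebra.
From mathcomp Require Import all_classical all_reals all_analysis.
From mathcomp Require Import measurable_realfun ring lra.
Import Order.TTheory GRing.Theory Num.Theory numFieldNormedType.Exports.
Local Open Scope classical_set_scope.
Local Open Scope ring_scope.

(* Let w(x) = 1 + |x|^eps, which is submultiplicative and subadditive up to
   constants.  Every f_n has integrable w f_n; f_n is bounded for n > k0,
   continuous for n > k0 + 1, and w f_n is bounded for n >= 2 (k0 + 1).

   Call h locally dominated if the local supremum of |h| over [x - 1, x + 1] is
   bounded by H(x) for some bounded integrable H.  Local domination survives
   convolution with an L^1 function, and a continuous locally dominated function
   is d.R.i.: its upper and lower sums are integrals of step functions dominated
   by H that converge to it pointwise.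

   To make some f_K locally dominated, start from h = f_q with w h bounded and
   integrable.  With u(x) = 1 / (1 + x^2), which is locally dominated, and
   N = 2^j large, |h|^N <= a^(N-1) u for a a multiple of w |h|.  By a Hoelder
   inequality for a product of three factors, if |h|^(2M) <= a^(2M-1) u then
   |h * h|^M <= (a * a)^(M-1) (2 (u * a)), and u * a is locally dominated.
     After
   j doublings M = 1, and local domination is reached.  The weight is restored
     at
   the end by w |g * h| <= C ((w |g|) * |h| + |g| * (w |h|)). *)

Set Implicit Arguments.
Unset Strict Implicit.
Unset Printing Implicit Defensive.

Local Notation conv := Defs.conv.

(** * Invariance of Lebesgue measure under reflections and translations *)

Section reflection.
Context {R : realType}.
Local Notation mu := (@lebesgue_measure R).

Lemma measurable_subl (x : R) :
  measurable_fun setT (fun y : measurableTypeR R => x - y : measurableTypeR R).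
Proof. exact: measurable_funB. Qed.

Lemma measurable_subr (y : R) :
  measurable_fun setT (fun x : measurableTypeR R => x - y : measurableTypeR R).
Proof. exact: measurable_funB. Qed.

Definition subl_mfun (x : R) : {mfun measurableTypeR R >-> measurableTypeR R} :=
  HB.pack (fun y : measurableTypeR R => x - y : measurableTypeR R)
    (isMeasurableFun.Build _ _ _ _ _ (measurable_subl x)).

Definition subr_mfun (y : R) : {mfun measurableTypeR R >-> measurableTypeR R} :=
  HB.pack (fun x : measurableTypeR R => x - y : measurableTypeR R)
    (isMeasurableFun.Build _ _ _ _ _ (measurable_subr y)).

(** By uniqueness of Lebesgue measure it is enough to test intervals []a, b]], whose preimage [[x -
    b, x - a[] has the same length. *)
Lemma lebesgue_measure_subl (x : R) (A : set (measurableTypeR R)) :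
  measurable A -> mu ((fun y => x - y) @^-1` A) = mu A.
Proof.
move=> mA; apply/esym.
rewrite (@lebesgue_measure_unique R (pushforward mu (subl_mfun x))) //.
move=> _ [[a b] _ <-] /=; rewrite /pushforward.
rewrite (_ : _ @^-1` _ = `[x - b, x - a[%classic); last first.
  by apply/seteqP; split=> y /=; rewrite !in_itv /=; lra.
rewrite !lebesgue_measure_itv /= !lte_fin ltrD2l ltrN2.
by case: ifP => // _; rewrite -!EFinB; congr (_%:E); ring.
Qed.

Lemma lebesgue_measure_subr (y : R) (A : set (measurableTypeR R)) :
  measurable A -> mu ((fun x => x - y) @^-1` A) = mu A.
Proof.
move=> mA; apply/esym.
rewrite (@lebesgue_measure_unique R (pushforward mu (subr_mfun y))) //.
move=> _ [[a b] _ <-] /=; rewrite /pushforward.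
rewrite (_ : _ @^-1` _ = `]a + y, b + y]%classic); last first.
  by apply/seteqP; split=> z /=; rewrite !in_itv /=; lra.
rewrite !lebesgue_measure_itv /= !lte_fin ltrD2r.
by case: ifP => // _; rewrite -!EFinB; congr (_%:E); ring.
Qed.

Lemma ge0_integral_subl (x : R) (f : R -> \bar R) :
  measurable_fun setT f -> (forall y, 0 <= f y)%E ->
  (\int[mu]_y f (x - y)%R = \int[mu]_y f y)%E.
Proof.
move=> mf f0.
have := @ge0_integral_pushforward _ _ (measurableTypeR R) (measurableTypeR R) R
  _ (measurable_subl x) mu setT f measurableT mf (fun y _ => f0 y).
rewrite preimage_setT => <-.
apply: eq_measure_integral => [|mphi A mA _]; [exact: measurable_subl|].
exact: lebesgue_measure_subl.
Qed.

Lemma ge0_integral_subr (y : R) (f : R -> \bar R) :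
  measurable_fun setT f -> (forall x, 0 <= f x)%E ->
  (\int[mu]_x f (x - y)%R = \int[mu]_x f x)%E.
Proof.
move=> mf f0.
have := @ge0_integral_pushforward _ _ (measurableTypeR R) (measurableTypeR R) R
  _ (measurable_subr y) mu setT f measurableT mf (fun x _ => f0 x).
rewrite preimage_setT => <-.
apply: eq_measure_integral => [|mphi A mA _]; [exact: measurable_subr|].
exact: lebesgue_measure_subr.
Qed.

Lemma integral_subl (x : R) (f : R -> \bar R) :
  measurable_fun setT f -> (\int[mu]_y f (x - y)%R = \int[mu]_y f y)%E.
Proof.
move=> mf; rewrite [RHS]integralE [LHS]integralE; congr (_ - _)%E.
  rewrite -(ge0_integral_subl x (measurable_funepos mf) (funepos_ge0 f)).
  by apply: eq_integral => z _; rewrite !funeposE.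
rewrite -(ge0_integral_subl x (measurable_funeneg mf) (funeneg_ge0 f)).
  by apply: eq_integral => z _; rewrite !funenegE.
Qed.

Lemma integral_subr (y : R) (f : R -> \bar R) :
  measurable_fun setT f -> (\int[mu]_x f (x - y)%R = \int[mu]_x f x)%E.
Proof.
move=> mf; rewrite [RHS]integralE [LHS]integralE; congr (_ - _)%E.
  rewrite -(ge0_integral_subr y (measurable_funepos mf) (funepos_ge0 f)).
  by apply: eq_integral => z _; rewrite !funeposE.
rewrite -(ge0_integral_subr y (measurable_funeneg mf) (funeneg_ge0 f)).
  by apply: eq_integral => z _; rewrite !funenegE.
Qed.

Lemma integrable_subl (x : R) (f : R -> R) :
  mu.-integrable setT (EFin \o f) ->
  mu.-integrable setT (EFin \o (fun y => f (x - y))).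
Proof.
move=> /integrableP[mf foo]; apply/integrableP; split.
  exact: (measurableT_comp mf (measurable_subl x)).
rewrite (@ge0_integral_subl x (fun y => `|(f y)%:E|%E)) //.
exact: measurableT_comp.
Qed.

Lemma ae_subl (x : R) (P : R -> Prop) :
  {ae mu, forall y, P y} -> {ae mu, forall y, P (x - y)}.
Proof.
move=> [N [mN N0 PN]]; exists ((fun y => x - y) @^-1` N); split.
- by rewrite -[X in measurable X]setTI; exact: measurable_subl.
- by rewrite -[RHS]N0; exact: lebesgue_measure_subl.
- by move=> y /= nP; exact: PN.
Qed.

End reflection.

(** * Convolution: measurability, integrability, bounds, commutativity and associativity *)

Section convolution.
Context {R : realType}.
Local Notation mu := (@lebesgue_measure R).
Local Notation L1 f := (mu.-integrable setT (EFin \o f)).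
Implicit Types f g h : R -> R.

Lemma L1_measurable f : L1 f -> measurable_fun setT f.
Proof. by move=> /integrableP[/measurable_EFinP]. Qed.

Lemma L1_le f g : measurable_fun setT f -> (forall x, `|f x| <= `|g x|) ->
  L1 g -> L1 f.
Proof.
move=> mf fg; apply: le_integrable => //; first exact/measurable_EFinP.
by move=> x _ /=; rewrite lee_fin.
Qed.

Lemma L1_norm f : L1 f -> L1 (fun x => `|f x|).
Proof. exact: integrable_norm. Qed.

Lemma L1_scale (c : R) f : L1 f -> L1 (fun x => c * f x).
Proof. exact: integrableZl. Qed.

Lemma L1_add f g : L1 f -> L1 g -> L1 (fun x => f x + g x).
Proof. by move=> L1f L1g; exact: (integrableD measurableT L1f L1g). Qed.

Lemma L1_sub f g : L1 f -> L1 g -> L1 (fun x => f x - g x).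
Proof. by move=> L1f L1g; exact: (integrableB measurableT L1f L1g). Qed.

Lemma measurable_conv_integrand g h :
  measurable_fun setT g -> measurable_fun setT h ->
  measurable_fun setT (fun z : measurableTypeR R * measurableTypeR R =>
    g (z.1 - z.2) * h z.2).
Proof.
move=> mg mh; apply: measurable_funM.
  apply: (measurableT_comp mg).
  by apply: measurable_funB; [exact: measurable_fst|exact: measurable_snd].
by apply: (measurableT_comp mh); exact: measurable_snd.
Qed.

Lemma measurable_conv_integrand1 g h x :
  measurable_fun setT g -> measurable_fun setT h ->
  measurable_fun setT (fun y : R => g (x - y) * h y).
Proof.
move=> mg mh; apply: measurable_funM => //.
exact: (measurableT_comp mg (measurable_subl x)).
Qed.

(** Sections of [F] may fail to be integrable, so Tonelli is applied to the positive and negative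
    parts separately. *)
Lemma measurable_integral2 (F : measurableTypeR R * measurableTypeR R -> \bar
  R) :
  measurable_fun setT F ->
  measurable_fun setT (fun x : R => \int[mu]_y F (x, y))%E.
Proof.
move=> mF; rewrite (_ : (fun x => _) =
  fun x => (\int[mu]_y F^\+ (x, y) - \int[mu]_y F^\- (x, y))%E); last first.
  apply/funext => x; rewrite integralE; congr (_ - _)%E.
    by apply: eq_integral => y _; rewrite !funeposE.
  by apply: eq_integral => y _; rewrite !funenegE.
apply: emeasurable_funB.
  exact: (@measurable_fun_fubini_tonelli_F _ _ (measurableTypeR R)
    (measurableTypeR R) R mu _ (measurable_funepos mF) (funepos_ge0 _)).
exact: (@measurable_fun_fubini_tonelli_F _ _ (measurableTypeR R)
  (measurableTypeR R) R mu _ (measurable_funeneg mF) (funeneg_ge0 _)).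
Qed.

Lemma measurable_conv g h : measurable_fun setT g -> measurable_fun setT h ->
  measurable_fun setT (conv g h).
Proof.
move=> mg mh; have mgh := measurable_conv_integrand mg mh.
apply: (measurableT_comp (fine_measurable measurableT)).
by apply: (measurable_integral2 (F := fun z => (g (z.1 - z.2) * h z.2)%:E));
  exact/measurable_EFinP.
Qed.

Lemma le_abs_conv g h x : measurable_fun setT g -> measurable_fun setT h ->
  (`|conv g h x|%:E <= \int[mu]_y (`|g (x - y)| * `|h y|)%:E)%E.
Proof.
move=> mg mh; have mgh := measurable_conv_integrand1 x mg mh.
apply: (@le_trans _ _ `|\int[mu]_y (g (x - y) * h y)%:E|%E).
  (* [fine] sends infinite values to 0, so the bound also holds at points where the convolution
     integral is infinite. *)
  rewrite /Defs.conv /Rintegral; set I := integral _ _ _.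
  by case: I => [r| |] /=; rewrite ?normr0 ?lexx ?le0y.
apply: le_trans (le_abse_integral _ _ _) _ => //; first exact/measurable_EFinP.
by under eq_integral do rewrite /= normrM.
Qed.

(** Tonelli, then translation invariance of the inner integral in [x]. *)
Lemma integral_conv_norm g h : measurable_fun setT g -> measurable_fun setT h ->
  (\int[mu]_x \int[mu]_y (`|g (x - y)| * `|h y|)%:E =
   (\int[mu]_x `|g x|%:E) * \int[mu]_y `|h y|%:E)%E.
Proof.
move=> mg mh.
have mng : measurable_fun setT (fun x => `|g x|) by exact: measurableT_comp.
have mnh : measurable_fun setT (fun x => `|h x|) by exact: measurableT_comp.
pose F (z : measurableTypeR R * measurableTypeR R) := (`|g (z.1 - z.2)| * `|h
  z.2|)%:E.
have mF : measurable_fun setT F.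
  by apply/measurable_EFinP; exact: (measurable_conv_integrand mng mnh).
transitivity (\int[mu]_y \int[mu]_x F (x, y))%E.
  by apply: (fubini_tonelli F mF) => z; rewrite lee_fin mulr_ge0.
transitivity (\int[mu]_y ((\int[mu]_x `|g x|%:E) * `|h y|%:E))%E.
  apply: eq_integral => y _.
  under eq_integral do rewrite /F /= mulrC EFinM.
  rewrite ge0_integralZl_EFin //; last first.
    apply/measurable_EFinP.
    exact: (measurableT_comp mng (measurable_subr y)).
  rewrite muleC; congr (_ * _)%E.
  apply: (@ge0_integral_subr _ y (fun x => `|g x|%:E)) => [|//].
  exact/measurable_EFinP.
rewrite ge0_integralZl //; first exact/measurable_EFinP.
exact: integral_ge0.
Qed.

(** Submultiplicativity moves the weight inside the integral: [w * |conv g h|] is at most [C] times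
    the convolution of [|w * g|] and [|w * h|], and Tonelli integrates the latter. The constant
    weight 1 gives [L1_conv]. *)
Lemma L1_conv_weight (w : R -> R) (C : R) g h : measurable_fun setT w ->
  (forall x, 0 <= w x) -> 0 <= C -> (forall x y, w (x + y) <= C * (w x * w y))
    ->
  measurable_fun setT g -> measurable_fun setT h ->
  L1 (fun x => w x * g x) -> L1 (fun x => w x * h x) ->
  L1 (fun x => w x * conv g h x).
Proof.
move=> mw w0 C0 wM mg mh /integrableP[mwg wgoo] /integrableP[mwh whoo].
have mgh := measurable_conv mg mh.
move/measurable_EFinP in mwg; move/measurable_EFinP in mwh.
have mng : measurable_fun setT (fun x => `|w x * g x|) by exact:
  measurableT_comp.
have mnh : measurable_fun setT (fun x => `|w x * h x|) by exact:
  measurableT_comp.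
have mI : measurable_fun setT
    (fun x : R => \int[mu]_y (`|w (x - y) * g (x - y)| * `|w y * h y|)%:E)%E.
  apply: (@measurable_integral2 (fun z =>
    (`|w (z.1 - z.2) * g (z.1 - z.2)| * `|w z.2 * h z.2|)%:E)).
  by apply/measurable_EFinP; exact: (measurable_conv_integrand mng mnh).
apply/integrableP; split.
  by apply/measurable_EFinP; exact: measurable_funM.
apply: (@le_lt_trans _ _ (\int[mu]_x (C%:E *
    \int[mu]_y (`|w (x - y) * g (x - y)| * `|w y * h y|)%:E))%E).
  apply: ge0_le_integral => //.
  - apply/measurable_EFinP/measurableT_comp => //; exact: measurable_funM.
  - exact: measurable_funeM.
  move=> x _ /=.
  rewrite normrM EFinM.
  apply: (@le_trans _ _ (`|w x|%:E * \int[mu]_y (`|g (x - y)| * `|h y|)%:E)%E).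
    by rewrite lee_wpmul2l ?lee_fin // le_abs_conv.
  have mng0 : measurable_fun setT (fun x => `|g x|) by exact: measurableT_comp.
  have mnh0 : measurable_fun setT (fun x => `|h x|) by exact: measurableT_comp.
  rewrite -!ge0_integralZl_EFin //.
  - apply: ge0_le_integral => //.
    + by apply: measurable_funeM; apply/measurable_EFinP;
        exact: (measurable_conv_integrand1 x mng0 mnh0).
    + by apply: measurable_funeM; apply/measurable_EFinP;
        exact: (measurable_conv_integrand1 x mng mnh).
    + move=> y _; rewrite -!EFinM lee_fin !normrM !(ger0_norm (w0 _)).
      have := wM (x - y) y; rewrite subrK => /(ler_wpM2r (mulr_ge0 (normr_ge0
        (g (x-y))) (normr_ge0 (h y)))).
      move=> /le_trans; apply; by rewrite le_eqVlt; apply/orP; left;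
        apply/eqP; ring.
  - by apply/measurable_EFinP; exact: (measurable_conv_integrand1 x mng mnh).
  - by apply/measurable_EFinP; exact: (measurable_conv_integrand1 x mng0 mnh0).
rewrite ge0_integralZl_EFin //.
- rewrite (@integral_conv_norm (fun x => w x * g x) (fun x => w x * h x)) //.
  rewrite lte_mul_pinfty ?lee_fin // lte_mul_pinfty ?integral_ge0 //.
  by rewrite ge0_fin_numE ?integral_ge0.
- by move=> x _; apply: integral_ge0 => y _; rewrite lee_fin mulr_ge0.
Qed.

Lemma L1_conv g h : L1 g -> L1 h -> L1 (conv g h).
Proof.
move=> L1g L1h.
have one u : (fun x => 1 * u x) = u by apply/funext => x; rewrite mul1r.
have := @L1_conv_weight (fun=> 1) 1 g h (measurable_cst _); rewrite !one.
by apply => //; [move=> *; rewrite !mul1r|exact: L1_measurable|exact: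
  L1_measurable].
Qed.

Lemma conv_comm g h : measurable_fun setT g -> measurable_fun setT h ->
  conv g h = conv h g.
Proof.
move=> mg mh; apply/funext => x; rewrite /Defs.conv /Rintegral; congr fine.
rewrite -(@integral_subl _ x (fun y => (g (x - y) * h y)%:E)).
  by apply: eq_integral => y _; rewrite opprB addrCA subrr addr0 mulrC.
by apply/measurable_EFinP; exact: measurable_conv_integrand1.
Qed.

Lemma L1_conv_integrand g h (M x : R) : measurable_fun setT g ->
  (forall y, `|g y| <= M) -> L1 h -> L1 (fun y => g (x - y) * h y).
Proof.
move=> mg gM L1h; have mh := L1_measurable L1h.
apply: L1_le (L1_scale M L1h); first exact: measurable_conv_integrand1.
move=> y; rewrite !normrM ler_wpM2r //.
by rewrite (le_trans (gM _)) // ler_norm.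
Qed.

Lemma conv_ae_bounded g h (M x : R) : measurable_fun setT g -> 0 <= M ->
  {ae mu, forall y, `|g y| <= M} -> L1 h ->
  `|conv g h x| <= M * \int[mu]_y `|h y|.
Proof.
move=> mg M0 gM L1h; have mh := L1_measurable L1h.
rewrite -lee_fin; apply: le_trans (le_abs_conv x mg mh) _.
rewrite -RintegralZl //; last exact: L1_norm.
rewrite /Rintegral fineK; last first.
  by apply: integrable_fin_num => //; exact/L1_scale/L1_norm.
have mng : measurable_fun setT (fun x => `|g x|) by exact: measurableT_comp.
have mnh : measurable_fun setT (fun x => `|h x|) by exact: measurableT_comp.
apply: ae_ge0_le_integral => //.
- by apply/measurable_EFinP; exact: (measurable_conv_integrand1 x mng mnh).
- by move=> y _; rewrite lee_fin mulr_ge0.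
- by apply/measurable_EFinP; exact: measurable_funM.
apply: filterS (ae_subl x gM); first exact: (ae_filter_ringOfSetsType mu).
by move=> y gy _; rewrite lee_fin ler_wpM2r.
Qed.

Lemma conv_bounded g h (M x : R) : measurable_fun setT g ->
  (forall y, `|g y| <= M) -> L1 h -> `|conv g h x| <= M * \int[mu]_y `|h y|.
Proof.
move=> mg gM L1h; apply: conv_ae_bounded => //.
  exact: le_trans (gM 0).
by apply: aeW.
Qed.

(** Fubini for g(x - y) h(y - z) k(z), which is integrable in (y, z) for every [x] because [g] is
    bounded. The identity therefore holds at every point, not only almost everywhere. *)
Lemma conv_assoc g h k (M : R) : measurable_fun setT g -> (forall y, `|g y| <=
  M) ->
  L1 h -> L1 k -> conv (conv g h) k = conv g (conv h k).
Proof.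
move=> mg gM L1h L1k; apply/funext => x; apply/esym.
have mh := L1_measurable L1h; have mk := L1_measurable L1k.
pose G (z : measurableTypeR R * measurableTypeR R) := h (z.1 - z.2) * k z.2.
pose F z := g (x - z.1) * G z.
have mG : measurable_fun setT G by exact: measurable_conv_integrand.
have mF : measurable_fun setT F.
  apply: measurable_funM => //; apply: (measurableT_comp mg).
  by apply: measurable_funB => //; exact: measurable_fst.
have iG : (mu \x mu)%E.-integrable setT (EFin \o G).
  apply/integrable12ltyP; first exact/measurable_EFinP.
  rewrite (_ : (\int[mu]_y _)%E =
      ((\int[mu]_x `|h x|%:E) * \int[mu]_y `|k y|%:E)%E); last first.
    apply: etrans (integral_conv_norm mh mk); apply: eq_integral => y _.
    by apply: eq_integral => z _; rewrite /= normrM.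
  case/integrableP: L1h => _ hoo; case/integrableP: L1k => _ koo.
  by rewrite lte_mul_pinfty // ?integral_ge0 // ge0_fin_numE ?integral_ge0.
have iF : (mu \x mu)%E.-integrable setT (EFin \o F).
  apply: (@le_integrable _ _ _ (mu \x mu)%E setT measurableT (EFin \o F) (EFin
    \o (fun z => M * G z))).
  - exact/measurable_EFinP.
  - move=> z _ /=; rewrite lee_fin !normrM ler_wpM2r ?normr_ge0 //.
    by rewrite (le_trans (gM _)) // ler_norm.
  - exact: (integrableZl measurableT M iG).
rewrite /Defs.conv /Rintegral; congr fine.
transitivity (\int[mu]_y \int[mu]_z (EFin \o F) (y, z))%E.
  (* For [y] in a null set the integral defining [conv h k y] may not converge absolutely, so the
     integrands are compared only almost everywhere. *)
  apply: ae_eq_integral => //.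
  - apply/measurable_EFinP.
    exact: (measurable_conv_integrand1 x mg (measurable_conv mh mk)).
  - by apply: measurable_integral2; exact/measurable_EFinP.
  - apply: filterS (ae_integrable1 iG) => y iy _.
    rewrite EFinM fineK; last exact: integrable_fin_num iy.
    by rewrite -integralZl.
rewrite (Fubini iF); apply: eq_integral => z _.
have L1gh := @L1_conv_integrand g h M (x - z) mg gM L1h.
transitivity (\int[mu]_y (g (x - z - y) * h y * k z)%:E)%E.
  rewrite -(@integral_subr _ z (fun y => (g (x - z - y) * h y * k z)%:E)).
    apply: eq_integral => y _; rewrite /F /G /= mulrA.
    by congr ((g _ * _ * _)%:E); ring.
  apply/measurable_EFinP; apply: measurable_funM => //.
  exact: measurable_conv_integrand1.
rewrite [RHS]EFinM fineK; last exact: integrable_fin_num L1gh.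
exact: (integralZr measurableT L1gh (k z)).
Qed.

End convolution.

(** * Continuity of the convolution of a bounded integrable function with an integrable one *)

Section continuity.
Context {R : realType}.
Local Notation mu := (@lebesgue_measure R).
Local Notation L1 f := (mu.-integrable setT (EFin \o f)).
Implicit Types f g h c : R -> R.

(** A continuous substitute for the indicator of [[-n, n]]. *)
Definition cutoff (n : nat) (x : R) : R := Num.max 0 (Num.min 1 (n%:R - `|x|)).

Lemma cutoff_ge0 n x : 0 <= cutoff n x.
Proof. by rewrite /cutoff le_max lexx. Qed.

Lemma cutoff_le1 n x : cutoff n x <= 1.
Proof. by rewrite /cutoff ge_max ler01 ge_min lexx. Qed.

Lemma cutoff_eq0 n x : n%:R <= `|x| -> cutoff n x = 0.
Proof.
move=> nx; rewrite /cutoff; apply/max_idPl.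
by rewrite ge_min subr_le0 nx orbT.
Qed.

Lemma cutoff_eq1 n x : `|x| + 1 <= n%:R -> cutoff n x = 1.
Proof.
move=> nx; rewrite /cutoff (min_idPl _); last by lra.
exact/max_idPr.
Qed.

Lemma continuous_cutoff n : continuous (cutoff n).
Proof.
move=> x; apply: (@continuous_max _ _ (fun=> 0) (fun x => Num.min 1 (n%:R -
  `|x|))).
  exact: cst_continuous.
apply: (@continuous_min _ _ (fun=> 1) (fun x => (n%:R - `|x|))).
  exact: cst_continuous.
by apply: cvgB; [exact: cvg_cst|exact: norm_continuous].
Qed.

Lemma L1_cutoff_cvg f : L1 f ->
  (\int[mu]_x `|f x - cutoff n x * f x| @[n --> \oo] --> 0)%R.
Proof.
move=> L1f; have mf := L1_measurable L1f.
pose F (n : nat) x := (cutoff n x * f x)%:E.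
have mc n : measurable_fun setT (cutoff n).
  by apply: continuous_measurable_fun; exact: continuous_cutoff.
have mF n : measurable_fun setT (F n).
  by apply/measurable_EFinP; exact: measurable_funM.
have mEf : measurable_fun setT (EFin \o f) by exact/measurable_EFinP.
have Ff : {ae mu, forall x, setT x -> F ^~ x @ \oo --> (EFin \o f) x}.
  apply: aeW => x _; apply: cvg_near_cst; rewrite /F.
  near=> n; rewrite cutoff_eq1 ?mul1r //.
  near: n; exact: nbhs_infty_ger.
have le_cutoff n x : `|cutoff n x * f x| <= `|f x|.
  by rewrite normrM ger0_norm ?cutoff_ge0 // ler_piMl // cutoff_le1.
have Fle : {ae mu, forall x n, setT x -> (`|F n x| <= `|f x|%:E)%E}.
  by apply: aeW => x n _; rewrite /F /= lee_fin.
have [_ DC _] := @dominated_convergence _ (measurableTypeR R) R mu setT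
  measurableT F (EFin \o f) _ mF mEf Ff (L1_norm L1f) Fle.
apply: cvg_trans (fine_cvg DC).
apply: near_eq_cvg; near=> n; rewrite /Rintegral /=; congr fine.
by apply: eq_integral => x _; rewrite /F /= distrC.
Unshelve. all: by end_near. Qed.

(* Multiplying by a cutoff makes the approximant of [f] on a compact interval
   continuous and bounded on the whole line. *)
Lemma L1_dense_continuous f (e : R) : L1 f -> 0 < e ->
  exists c, [/\ continuous c, (exists M : R, forall x, `|c x| <= M), L1 c &
    \int[mu]_x `|f x - c x| <= e].
Proof.
move=> L1f e0; have mf := L1_measurable L1f.
have e20 : 0 < e / 2 by rewrite divr_gt0.
have [n fn] : exists n, \int[mu]_x `|f x - cutoff n x * f x| <= e / 2.
  have /cvgrPdist_le/(_ _ e20) [n _ /(_ n (leqnn n))] := L1_cutoff_cvg L1f.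
  by rewrite /= sub0r normrN => H; exists n; apply: le_trans H; exact: ler_norm.
pose E := `[- n%:R, n%:R]%classic : set R.
have mE : measurable E by exact: measurable_itv.
have L1fE : mu.-integrable E (EFin \o f) by exact: integrableS L1f.
have Efin : (mu E < +oo)%E.
  by rewrite /E lebesgue_measure_itv /=; case: ifP => // _; rewrite -EFinB ltry.
have [g_ [cg ig cvg]] := @approximation_continuous_integrable R E f mE Efin
  L1fE.
have [m gm] : exists m, (\int[mu]_(x in E) `|(f x - g_ m x)%:E| <= (e /
  2)%:E)%E.
  have /fine_cvgP[_ /cvgrPdist_le/(_ _ e20) [m _ /(_ m (leqnn m))]] := cvg.
  rewrite /= sub0r normrN => gm; exists m.
  rewrite -[leLHS]fineK; first by rewrite lee_fin (le_trans (ler_norm _)).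
  have iE := @integrableB _ (measurableTypeR R) R mu E mE _ _ L1fE (ig m).
  exact: (@integrable_fin_num _ (measurableTypeR R) R mu E mE _
    (integrable_abse iE)).
pose g := g_ m.
exists (fun x => cutoff n x * g x).
have cc : continuous (fun x => cutoff n x * g x).
  by move=> x; apply: cvgM; [exact: continuous_cutoff|exact: cg].
have mcg : measurable_fun setT (fun x => cutoff n x * g x).
  exact: continuous_measurable_fun.
have mc : measurable_fun setT (cutoff n).
  by apply: continuous_measurable_fun; exact: continuous_cutoff.
have mg : measurable_fun setT g by apply: continuous_measurable_fun; exact: cg.
(* The total error [f - cutoff n * g] equals [(f - cutoff n * f) + r], and [r] vanishes outside [E],
   so the estimate on [E] controls it on the whole line. *)
pose r x := cutoff n x * (f x - g x).
have mr : measurable_fun setT r.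
  by apply: measurable_funM => //; exact: measurable_funB.
have re : (\int[mu]_x `|r x|%:E <= (e / 2)%:E)%E.
  apply: le_trans gm; rewrite [leRHS]integral_mkcond.
  apply: ge0_le_integral => //.
  - by apply/measurable_EFinP; exact: measurableT_comp.
  - apply/(measurable_restrictT _ mE)/measurable_EFinP/measurableT_comp => //.
    by apply: measurable_funTS; exact: measurable_funB.
  move=> x _; rewrite patchE; case: ifPn => xE.
    by rewrite lee_fin normrM ger0_norm ?cutoff_ge0 // ler_piMl // cutoff_le1.
  rewrite lee_fin /r cutoff_eq0 ?mul0r ?normr0 //.
  move: xE; rewrite notin_setE /E /= in_itv /= => /negP.
  by rewrite -ler_norml -ltNge => /ltW.
have L1r : L1 r.
  apply/integrableP; split; first exact/measurable_EFinP.
  exact: le_lt_trans re (ltry _).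
have L1d : L1 (fun x => f x - cutoff n x * f x).
  apply: L1_sub => //; apply: L1_le L1f; first exact: measurable_funM.
  move=> x; rewrite normrM ger0_norm ?cutoff_ge0 //.
  by rewrite ler_piMl // cutoff_le1.
have E1 : (fun x => f x - cutoff n x * g x) = (fun x => (f x - cutoff n x * f
  x) + r x).
  by apply/funext => x; rewrite /r; ring.
have L1fc : L1 (fun x => f x - cutoff n x * g x) by rewrite E1; exact: L1_add.
split=> //.
- have [M Mg] : exists M, forall x, E x -> `|g x| <= M.
    have cE : compact (g @` E).
      by apply: continuous_compact (@segment_compact R _ _);
        apply: continuous_subspaceT => z; exact: cg.
    have /compact_bounded[M [_ mrt]] := cE.
    exists (M + 1) => x Ex; apply: (mrt (M + 1)); first by rewrite ltrDl.
    by exists x.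
  exists M => x; have [xn|xn] := leP `|x| n%:R.
    rewrite normrM ger0_norm ?cutoff_ge0 //; apply: le_trans (Mg x _).
      by rewrite ler_piMl // cutoff_le1.
    by rewrite /E /= in_itv /= -ler_norml.
  rewrite cutoff_eq0 ?(ltW xn) // mul0r normr0 (le_trans _ (Mg 0 _)) //.
  by rewrite /E /= in_itv /= oppr_le0 !ler0n.
- rewrite (_ : (fun x => _) = (fun x => f x - (f x - cutoff n x * g x)));
    first exact: L1_sub.
  by apply/funext => x; ring.
have ir : \int[mu]_x `|r x| <= e / 2.
  rewrite -lee_fin /Rintegral fineK //.
  by apply: integrable_fin_num => //; exact: L1_norm.
rewrite (splitr e); apply: le_trans (lerD fn ir).
rewrite -RintegralD //; [|exact: L1_norm|exact: L1_norm].
apply: le_Rintegral => //; [exact: L1_norm| |].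
  by apply: L1_add; exact: L1_norm.
by move=> x _; rewrite [X in `|X|](_ : _ = (f x - cutoff n x * f x) + r x)
  ?ler_normD // /r; ring.
Qed.

(** Continuity under the integral sign, with dominating function [M * |g|]. *)
Lemma continuous_conv_bounded_continuous c g (M : R) : continuous c ->
  (forall x, `|c x| <= M) -> L1 g -> continuous (conv c g).
Proof.
move=> cc cM L1g x.
have mc := continuous_measurable_fun cc.
apply: (@continuity_under_integral R _ _ mu (fun x y => c (x - y) * g y) setT
  measurableT (x - 1) (x + 1) _ _ (fun y => M * `|g y|)).
- by move=> u _; exact: L1_conv_integrand cM L1g.
- apply: aeW => y _ u _.
  apply: cvgM; last exact: cvg_cst.
  apply: (@continuous_comp R R R (fun z => z - y) c); last exact: cc.
  by apply: cvgB; [exact: cvg_id|exact: cvg_cst].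
- exact/L1_scale/L1_norm.
- by move=> u _; apply: aeW => y _; rewrite normrM ler_wpM2r.
by rewrite inE /= in_itv /=; apply/andP; split; lra.
Qed.

(** If [c] is continuous, bounded and close to [h] in L^1, then [conv g c] is uniformly close to
    [conv g h] because [g] is bounded, and [conv g c = conv c g] is continuous. *)
Lemma continuous_conv g h (M : R) : L1 g -> (forall x, `|g x| <= M) -> L1 h ->
  continuous (conv g h).
Proof.
move=> L1g gM L1h x; apply/cvgrPdist_le => e e0.
have M0 : 0 <= M := le_trans (normr_ge0 _) (gM 0).
(* [M + 1] rather than [M] keeps the denominator positive when [M = 0]. *)
have d0 : 0 < e / (3 * (M + 1)) by rewrite divr_gt0 // mulr_gt0 // ltr_wpDl.
have [c [cc [N cN] L1c hc]] := L1_dense_continuous L1h d0.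
have mg := L1_measurable L1g; have mh := L1_measurable L1h.
have mc := L1_measurable L1c.
have close u : `|conv g h u - conv g c u| <= e / 3.
  rewrite [X in `|X|](_ : _ = conv g (fun y => h y - c y) u); last first.
    rewrite /Defs.conv -RintegralB //; [|exact: L1_conv_integrand gM _..].
    by apply: eq_Rintegral => y _; rewrite mulrBr.
  apply: le_trans (conv_bounded u mg gM (L1_sub L1h L1c)) _.
  apply: le_trans (ler_wpM2l M0 hc) _.
  have M10 : 0 < M + 1 by rewrite ltr_wpDl.
  have -> : M * (e / (3 * (M + 1))) = e / 3 * (M / (M + 1)).
    by field; rewrite gt_eqF.
  rewrite ler_piMr ?divr_ge0 ?(ltW e0) //.
  by rewrite ler_pdivrMr ?mul1r ?lerDl.
have cgc := @continuous_conv_bounded_continuous c g N cc cN L1g x.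
have e30 : 0 < e / 3 by rewrite divr_gt0.
rewrite -(conv_comm mg mc) in cgc.
move/cvgrPdist_le : cgc => /(_ _ e30).
apply: filterS => u cu.
have -> : conv g h x - conv g h u = (conv g h x - conv g c x) +
  (conv g c x - conv g c u) + (conv g c u - conv g h u) by ring.
apply: le_trans (ler_normD _ _) _.
have := close u; rewrite distrC => cl.
have := ler_normD (conv g h x - conv g c x) (conv g c x - conv g c u).
have := close x.
lra.
Qed.

End continuity.

(** * Direct Riemann integrability of continuous locally dominated functions *)

Section direct_Riemann_integrability.
Context {R : realType}.
Local Notation mu := (@lebesgue_measure R).
Local Notation L1 f := (mu.-integrable setT (EFin \o f)).

Lemma ereal_cvg_fin (T : Type) (F : set_system T) (FF : Filter F)
    (f : T -> \bar R) (l : R) :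
  (forall e : R, 0 < e ->
    \forall x \near F, ((l - e)%:E <= f x <= (l + e)%:E)%E) ->
  f @ F --> l%:E.
Proof.
move=> H; have fin e : 0 < e -> \forall x \near F,
    f x \is a fin_num /\ `|l - fine (f x)| <= e.
  move=> e0; apply: filterS (H _ e0) => x.
  case: (f x) => [r| |]; [|by rewrite leye_eq andbF|by rewrite leeNy_eq].
  by rewrite !lee_fin /= => /andP[? ?]; split => //; rewrite ler_norml; lra.
apply/fine_cvgP; split; first by apply: filterS (fin 1 ltr01) => x [].
by apply/cvgrPdist_le => e /fin; apply: filterS => x [].
Qed.

Definition cell (d : R) (m : int) : set R := `[m%:~R * d, (m%:~R + 1) *
  d[%classic.

Lemma cell_floor (d x : R) : 0 < d -> cell d (Num.floor (x / d)) x.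
Proof.
move=> d0; rewrite /cell /= in_itv /=; have /andP[] := floor_itv (x / d).
by rewrite ler_pdivlMr // ltr_pdivrMr // intrD => -> ->.
Qed.

Lemma floor_cell (d x : R) (m : int) : 0 < d -> cell d m x -> Num.floor (x / d)
  = m.
Proof.
move=> d0; rewrite /cell /= in_itv /= => /andP[mx xm]; apply: floor_def.
by rewrite ler_pdivlMr // ltr_pdivrMr // intrD mx xm.
Qed.

Lemma cell_dist (d x y : R) (m : int) : cell d m x -> cell d m y -> `|x - y| <=
  d.
Proof.
by rewrite /cell /= !in_itv /= mulrDl mul1r ler_norml => /andP[? ?] /andP[? ?];
  lra.
Qed.

Lemma measurable_cell (d : R) (m : int) : measurable (cell d m : set
  (measurableTypeR R)).
Proof. exact: measurable_itv. Qed.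

Lemma lebesgue_measure_cell (d : R) (m : int) : 0 < d -> mu (cell d m) = d%:E.
Proof.
move=> d0; rewrite /cell lebesgue_measure_itv /= lte_fin ltr_pM2r // ltrDl
  ltr01.
by rewrite -EFinB; congr (_%:E); ring.
Qed.

(** Enumerates the integers as 0, -1, 1, -2, 2, ..., so that the cells form a sequence. *)
Definition int_of_nat (n : nat) : int := if odd n then Negz n./2 else Posz n./2.

Lemma int_of_nat_bij : bijective int_of_nat.
Proof.
exists (fun z => match z with Posz k => k.*2 | Negz k => k.*2.+1 end).
  by move=> n; rewrite /int_of_nat -[RHS]odd_double_half; case: (odd n).
by case=> k; rewrite /int_of_nat /= odd_double ?doubleK //= uphalf_double.
Qed.

Lemma measurable_cellwise (d : R) (E : int -> \bar R) : 0 < d ->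
  measurable_fun setT (fun x : measurableTypeR R => E (Num.floor (x / d))).
Proof.
move=> d0; rewrite (_ : setT = \bigcup_n cell d (int_of_nat n)); last first.
  apply/esym; rewrite -subTset => x _; have [g _ gK] := int_of_nat_bij.
  by exists (g (Num.floor (x / d))) => //; rewrite gK; exact: cell_floor.
apply/measurable_fun_bigcup => [i|i]; first exact: measurable_cell.
apply: (eq_measurable_fun (cst (E (int_of_nat i)))) => [x|].
  by rewrite inE => /(floor_cell d0) ->.
exact: measurable_cst.
Qed.

(** The step function equals [E m] on the [m]-th cell, which has measure [d]. Writing the sum as an
    integral gives access to dominated convergence. *)
Lemma esum_cells (d : R) (E : int -> \bar R) : 0 < d -> (forall m, 0 <= E m)%E
  ->
  (\esum_(m in [set: int]) (d%:E * E m) =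
   \int[mu]_x E (Num.floor (x / d)%R))%E.
Proof.
move=> d0 E0; have [g gK Kg] := int_of_nat_bij.
rewrite (@reindex_esum _ _ _ setT setT int_of_nat); last first.
  by rewrite setTT_bijective; exact: int_of_nat_bij.
rewrite -nneseries_esumT; last by move=> n; rewrite mule_ge0 // lee_fin ltW.
have covT : setT = \bigcup_n (cell d (int_of_nat n) : set (measurableTypeR R)).
  apply/esym; rewrite -subTset => x _.
  by exists (g (Num.floor (x / d))) => //; rewrite Kg; exact: cell_floor.
rewrite [in RHS]covT ge0_integral_bigcup //.
- apply: eq_eseriesr => n _.
  transitivity (\int[mu]_(x in cell d (int_of_nat n)) cst (E (int_of_nat n))
    x)%E.
    rewrite integral_cst; last exact: measurable_cell.
    by rewrite muleC; congr (_ * _)%E; exact/esym/lebesgue_measure_cell.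
  by apply: eq_integral => x; rewrite inE => /(floor_cell d0) ->.
- by move=> k; exact: measurable_cell.
- by rewrite -covT; exact: measurable_cellwise.
- apply/trivIsetP => i j _ _ ij; rewrite -subset0 => x [/(floor_cell d0) xi].
  move=> /(floor_cell d0); rewrite xi => /(can_inj gK) eij.
  by rewrite eij eqxx in ij.
Qed.

(* Covers the upper and the lower sums: [E d m] is the supremum or the infimum
   of [g] on the [m]-th cell. *)
Lemma cell_sum_cvg (E : R -> int -> \bar R) (g H : R -> R) :
  measurable_fun setT g -> L1 H ->
  (forall (d : R) m, 0 < d -> (0 <= E d m)%E) ->
  (forall d x : R, 0 < d -> d <= 1 -> (E d (Num.floor (x / d)) <= (H x)%:E)%E)
    ->
  (forall x, E d (Num.floor (x / d)) @[d --> 0^'+] --> (g x)%:E) ->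
  (\esum_(m in [set: int]) (d%:E * E d m))%E @[d --> 0^'+] -->
    (\int[mu]_x g x)%:E.
Proof.
move=> mg L1H E0 EH Eg.
pose U d x := E d (Num.floor (x / d)).
have finU d : 0 < d -> d <= 1 -> (\int[mu]_x U d x)%E \is a fin_num.
  move=> d0 d1; rewrite ge0_fin_numE; last by apply: integral_ge0 => x _;
    exact: E0.
  case/integrableP : L1H => mH; apply: le_lt_trans.
  apply: ge0_le_integral => //.
  - by move=> x _; exact: E0.
  - exact: measurable_cellwise.
  - exact: measurableT_comp.
  - move=> x _; apply: le_trans (EH d x d0 d1) _.
    by rewrite /= lee_fin ler_norm.
(* [H] dominates only for meshes at most 1. Truncating the mesh at 1 makes the domination valid
   along every positive sequence and does not affect the limit at 0. *)
pose V (d : R) := fine (\int[mu]_x U (Num.min d 1)%R x)%E.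
have V_near : \forall d \near 0^'+, (V d)%:E = (\esum_(m in [set: int]) (d%:E *
  E d m))%E.
  near=> d; have d0 : 0 < d by near: d; exact: nbhs_right_gt.
  have d1 : d <= 1 by near: d; exact: nbhs_right_le.
  by rewrite /V (min_idPl d1) fineK ?finU // esum_cells // => m; exact: E0.
suff Vg : V d @[d --> 0^'+] --> \int[mu]_x g x.
  apply/fine_cvgP; split; first by apply: filterS V_near => d <-.
  by apply: cvg_trans Vg; apply: near_eq_cvg; apply: filterS V_near => d /= <-.
apply/cvg_at_rightP => u [u0 ucvg].
pose v n := Num.min (u n) 1.
have v0 n : 0 < v n by rewrite lt_min u0 ltr01.
have v1 n : v n <= 1 by rewrite ge_min lexx orbT.
have vcvg : v n @[n --> \oo] --> 0^'+.
  move=> P [r /= r0 Pr]; move/cvgrPdist_lt : ucvg => /(_ r r0).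
  apply: filterS => n /= un; apply: Pr => //=.
  move: un; rewrite !sub0r !normrN !gtr0_norm //.
  by apply: le_lt_trans; rewrite ge_min lexx.
have mU n : measurable_fun setT (U (v n)) by exact: measurable_cellwise.
have mEg : measurable_fun setT (EFin \o g) by exact/measurable_EFinP.
have Ug : {ae mu, forall x, setT x -> U (v n) x @[n --> \oo] --> (EFin \o g) x}.
  by apply: aeW => x _; exact: cvg_comp vcvg (Eg x).
have UH : {ae mu, forall x n, setT x -> (`|U (v n) x| <= (H x)%:E)%E}.
  by apply: aeW => x n _; rewrite gee0_abs ?E0 // EH.
have [L1g _ DC] := @dominated_convergence _ (measurableTypeR R) R mu setT
  measurableT (fun n => U (v n)) (EFin \o g) _ mU mEg Ug L1H UH.
apply: fine_cvg; rewrite /Rintegral fineK //; exact: integrable_fin_num.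
Unshelve. all: by end_near. Qed.

(** Radius 1 suffices since only meshes at most 1 matter. Boundedness of [H] is included so that its
    convolution with an L^1 function is again bounded. *)
Definition loc_dominated (f : R -> R) : Prop := exists H : R -> R,
  [/\ L1 H, (exists M : R, forall x, `|H x| <= M) &
      forall x t, `|t| <= 1 -> `|f (x + t)| <= H x].

(** For mesh at most 1 the cell containing [x] lies within distance 1 of [x], so [H] dominates the
    step functions of both sums. Continuity makes these converge to [g], and the common limit of the
    sums is the integral of [g]. *)
Lemma continuous_loc_dominated_dRi_nonneg (g : R -> R) : continuous g ->
  (forall x, 0 <= g x) -> loc_dominated g -> dRi_nonneg g.
Proof.
move=> cg g0 [H [L1H _ gH]].
have mg : measurable_fun setT g by exact: continuous_measurable_fun.
have cell_near x (e : R) : 0 < e -> \forall d \near 0^'+, 0 < d /\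
    forall z, cell d (Num.floor (x / d)) z -> g x - e <= g z <= g x + e.
  move=> e0; have /cvgrPdist_le/(_ e e0) [r /= r0 gr] := cg x.
  near=> d; have d0 : 0 < d by near: d; exact: nbhs_right_gt.
  have dr : d < r by near: d; exact: nbhs_right_lt.
  split=> // z /(cell_dist (cell_floor x d0)) xz.
  have := gr z (le_lt_trans xz dr).
  by rewrite ler_norml; lra.
exists (\int[mu]_x g x); split.
- apply: (@cell_sum_cvg (fun d m => ereal_sup [set (g z)%:E | z in cell d m]) g
    H) => //.
  + move=> d m d0; apply: (@le_trans _ _ (g (m%:~R * d))%:E);
      first by rewrite lee_fin.
    apply: ereal_sup_ubound; exists (m%:~R * d) => //.
    by rewrite /cell /= in_itv /= lexx /= ltr_pM2r // ltrDl.
  + move=> d x d0 d1; apply: ge_ereal_sup => _ [z cz <-].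
    have := gH x (z - x); rewrite subrKC lee_fin => gz.
    rewrite (le_trans (ler_norm _)) // gz //.
    rewrite distrC (le_trans _ d1) //; exact: (cell_dist (cell_floor x d0) cz).
  + move=> x; apply: ereal_cvg_fin => e e0.
    apply: filterS (cell_near x e e0) => d [d0 gz]; apply/andP; split.
      apply: (@le_trans _ _ (g x)%:E); first by rewrite lee_fin; lra.
      by apply: ereal_sup_ubound; exists x => //; exact: cell_floor.
    by apply: ge_ereal_sup => _ [z cz <-]; rewrite lee_fin;
      have /andP[] := gz z cz.
- apply: (@cell_sum_cvg (fun d m => ereal_inf [set (g z)%:E | z in cell d m]) g
    H) => //.
  + by move=> d m d0; apply: le_ereal_inf_tmp => _ [z cz <-]; rewrite lee_fin.
  + move=> d x d0 d1; apply: (@le_trans _ _ (g x)%:E).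
      by apply: ereal_inf_lbound; exists x => //; exact: cell_floor.
    have := gH x 0; rewrite addr0 normr0 ler01 lee_fin => /(_ isT).
    exact: le_trans (ler_norm _).
  + move=> x; apply: ereal_cvg_fin => e e0.
    apply: filterS (cell_near x e e0) => d [d0 gz]; apply/andP; split.
      by apply: le_ereal_inf_tmp => _ [z cz <-]; rewrite lee_fin;
        have /andP[] := gz z cz.
    apply: (@le_trans _ _ (g x)%:E); last by rewrite lee_fin; lra.
    by apply: ereal_inf_lbound; exists x => //; exact: cell_floor.
Unshelve. all: by end_near. Qed.

Lemma continuous_loc_dominated_dRi (g : R -> R) : continuous g ->
  loc_dominated g -> dRi g.
Proof.
move=> cg [H [L1H bH gH]]; split; apply: continuous_loc_dominated_dRi_nonneg.
- move=> x; apply: (@continuous_max _ _ g (fun=> 0)); first exact: cg.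
  exact: cst_continuous.
- by move=> x; rewrite le_max lexx orbT.
- exists H; split=> // x t t1; apply: le_trans (gH x t t1).
  by rewrite ger0_norm ?le_max ?lexx ?orbT // ge_max ler_norm normr_ge0.
- move=> x; apply: (@continuous_max _ _ (fun x => - g x) (fun=> 0)).
    by apply: cvgN; exact: cg.
  exact: cst_continuous.
- by move=> x; rewrite le_max lexx orbT.
- exists H; split=> // x t t1; apply: le_trans (gH x t t1).
  by rewrite ger0_norm ?le_max ?lexx ?orbT // ge_max -normrN ler_norm normr_ge0.
Qed.

End direct_Riemann_integrability.

(** * Local domination, a Hoelder inequality, and interpolation with integrability *)

Section local_domination.
Context {R : realType}.
Local Notation mu := (@lebesgue_measure R).
Local Notation L1 f := (mu.-integrable setT (EFin \o f)).
Implicit Types f g h G K a al : R -> R.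

Lemma conv_fineK g h (M x : R) : measurable_fun setT g -> (forall y, `|g y| <=
  M) ->
  L1 h -> (conv g h x)%:E = (\int[mu]_y (g (x - y) * h y)%:E)%E.
Proof.
move=> mg gM L1h; rewrite /Defs.conv /Rintegral fineK //.
by apply: integrable_fin_num => //; exact: L1_conv_integrand gM L1h.
Qed.

(** Two base points are allowed because local domination compares the value at [x' = x + t] with a
    majorant at [x]. *)
Lemma norm_conv_le g h G K (M x x' : R) :
  measurable_fun setT g -> measurable_fun setT h ->
  measurable_fun setT G -> (forall y, `|G y| <= M) -> L1 K ->
  (forall y, `|g (x' - y)| * `|h y| <= G (x - y) * K y) ->
  `|conv g h x'| <= conv G K x.
Proof.
move=> mg mh mG GM L1K le_gG; rewrite -lee_fin (conv_fineK x mG GM L1K).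
apply: le_trans (le_abs_conv x' mg mh) _.
have mng : measurable_fun setT (fun x => `|g x|) by exact: measurableT_comp.
have mnh : measurable_fun setT (fun x => `|h x|) by exact: measurableT_comp.
apply: ge0_le_integral => //.
- by apply/measurable_EFinP; exact: (measurable_conv_integrand1 x' mng mnh).
- apply/measurable_EFinP.
  exact: (measurable_conv_integrand1 x mG (L1_measurable L1K)).
- by move=> y _; rewrite lee_fin.
Qed.

Lemma loc_dominated_bounded f : loc_dominated f -> exists M : R, forall x, `|f
  x| <= M.
Proof.
move=> [H [_ [M HM] fH]]; exists M => x.
have := fH x 0; rewrite addr0 normr0 ler01 => /(_ isT) /le_trans; apply.
exact: le_trans (ler_norm _) (HM x).
Qed.

Lemma loc_dominated_le f g : (forall x, `|f x| <= `|g x|) -> loc_dominated g ->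
  loc_dominated f.
Proof.
by move=> fg [H [L1H bH gH]]; exists H; split=> // x t t1;
  exact: le_trans (fg _) (gH _ _ t1).
Qed.

Lemma loc_dominated_add f g : loc_dominated f -> loc_dominated g ->
  loc_dominated (fun x => f x + g x).
Proof.
move=> [H [L1H [M HM] fH]] [H' [L1H' [M' HM'] gH]];
  exists (fun x => H x + H' x).
split; first exact: L1_add.
  by exists (M + M') => x; rewrite (le_trans (ler_normD _ _)) // lerD.
by move=> x t t1; rewrite (le_trans (ler_normD _ _)) // lerD ?fH ?gH.
Qed.

Lemma loc_dominated_scale (c : R) f : loc_dominated f ->
  loc_dominated (fun x => c * f x).
Proof.
move=> [H [L1H [M HM] fH]]; exists (fun x => `|c| * H x).
split; first exact: L1_scale.
  by exists (`|c| * M) => x; rewrite normrM normr_id ler_wpM2l.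
by move=> x t t1; rewrite normrM ler_wpM2l ?fH.
Qed.

Lemma loc_dominated_norm f : loc_dominated f -> loc_dominated (fun x => `|f x|).
Proof. by apply: loc_dominated_le => x; rewrite normr_id. Qed.

(** A shift of the argument falls on the first factor alone, so [conv H |h|] dominates. *)
Lemma loc_dominated_conv g h : measurable_fun setT g -> loc_dominated g -> L1 h
  ->
  loc_dominated (conv g h).
Proof.
move=> mg [H [L1H [M HM] gH]] L1h; have mH := L1_measurable L1H.
have L1nh := L1_norm L1h.
exists (conv H (fun x => `|h x|)); split; first exact: L1_conv.
  by exists (M * \int[mu]_y `| `|h y| |) => x; exact: conv_bounded.
move=> x t t1; apply: (norm_conv_le mg (L1_measurable L1h) mH HM L1nh) => y.
by rewrite ler_wpM2r // addrAC gH.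
Qed.

(** The convex function z^(m+1) lies above its tangent at [s]. The induction multiplies by [z] and
    uses (m+1) s^m (z - s)^2 >= 0. *)
Lemma tangent_le_expr (m : nat) (s z : R) : 0 <= s -> 0 <= z ->
  m.+1%:R * (s ^+ m * z) <= z ^+ m.+1 + m%:R * s ^+ m.+1.
Proof.
move=> s0 z0; elim: m => [|m IH];
  first by rewrite expr0 expr1 !mul1r mul0r addr0.
have := ler_wpM2r z0 IH.
have := mulr_ge0 (mulr_ge0 (ler0n R m.+1) (exprn_ge0 m s0)) (sqr_ge0 (z - s)).
rewrite !exprS -[m.+2]addn1 -[m.+1]addn1 !natrD.
move: (s ^+ m) (z ^+ m) (m%:R : R) => a b c; nra.
Qed.

(* The weighted AM-GM inequality, in a form that is linear in [z], [x] and [y]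
   and hence can be integrated. *)
Lemma geometric_mean_le_linear (m : nat) (l x y z : R) : 0 < l -> 0 <= x ->
  0 <= y -> 0 <= z -> z ^+ m.+1 <= x ^+ m * y ->
  m.+1%:R * l ^+ m * z <= m%:R * l ^+ m.+1 * x + y.
Proof.
move=> l0 x0 y0 z0; have [x_gt0 zxy|x_le0] := ltP 0 x; last first.
  have -> : x = 0 by apply/eqP; rewrite eq_le x_le0.
  case: m => [|m]; first by rewrite !expr0 expr1 !mul1r !mul0r add0r.
  rewrite expr0n /= mul0r => zm.
  have : z ^+ m.+2 == 0 by rewrite eq_le zm exprn_ge0.
  by rewrite expf_eq0 => /andP[_ /eqP ->]; rewrite !mulr0 add0r.
have xm : 0 < x ^+ m by rewrite exprn_gt0.
(* The tangent is taken at [l * x], and the common factor [x ^+ m] is then cancelled. *)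
have := tangent_le_expr m (mulr_ge0 (ltW l0) x0) z0.
rewrite !exprMn [x ^+ m.+1]exprS => tangent.
rewrite -(ler_pM2l xm); move: tangent zxy.
move: (z ^+ m.+1) (x ^+ m) (l ^+ m) (l ^+ m.+1) => zm xm' lm lm1.
move: (m%:R : R) (m.+1%:R : R) => k k1; lra.
Qed.

(** Hoelder with exponents (m+1)/m and m+1, free of roots: the linear inequality is integrated for
    every [l > 0], and [l] is optimised afterwards. *)
Lemma Rintegral_geometric_mean_le (m : nat) (X Y Z : R -> R) :
  L1 X -> L1 Y -> L1 Z -> (forall y, 0 <= X y) -> (forall y, 0 <= Y y) ->
  (forall y, 0 <= Z y) -> (forall y, Z y ^+ m.+1 <= X y ^+ m * Y y) ->
  (\int[mu]_y Z y) ^+ m.+1 <= (\int[mu]_y X y) ^+ m * \int[mu]_y Y y.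
Proof.
move=> L1X L1Y L1Z X0 Y0 Z0 ZXY.
have lin (l : R) : 0 < l -> m.+1%:R * l ^+ m * (\int[mu]_y Z y) <=
    m%:R * l ^+ m.+1 * (\int[mu]_y X y) + \int[mu]_y Y y.
  move=> l0; rewrite -!RintegralZl // -RintegralD //; last exact: L1_scale.
  apply: le_Rintegral => //; [exact: L1_scale|by apply: L1_add => //;
    exact: L1_scale|].
  by move=> y _; exact: geometric_mean_le_linear.
have : 0 <= \int[mu]_y X y by exact: Rintegral_ge0.
have : 0 <= \int[mu]_y Y y by exact: Rintegral_ge0.
have : 0 <= \int[mu]_y Z y by exact: Rintegral_ge0.
move: (\int[mu]_y X y) (\int[mu]_y Y y) (\int[mu]_y Z y) lin => IX IY IZ lin.
rewrite le_eqVlt => /predU1P[<-|IZ0] IY0.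
  by move=> IX0; rewrite expr0n /= mulr_ge0 // exprn_ge0.
rewrite le_eqVlt => /predU1P[IX0|IX0].
  move: lin; rewrite -IX0; case: m {ZXY} => [|m] lin.
    have := lin 1 ltr01; rewrite !expr0 expr1 mulr0 add0r !mul1r.
    by [].
  (* With [IX = 0] and a positive power of [l], the bound would keep a positive multiple of that
     power below [IY] for all [l]. It fails at this [l], where [l * IZ = IZ + IY]. *)
  have l1 : 1 <= 1 + IY / IZ by rewrite lerDl divr_ge0 // ltW.
  have := lin (1 + IY / IZ) (lt_le_trans ltr01 l1); rewrite mulr0 add0r => H.
  exfalso; move: H; apply/negP; rewrite -ltNge.
  have lIZ : (1 + IY / IZ) * IZ = IZ + IY by rewrite mulrDl mul1r divfK //
    gt_eqF.
  apply: (@lt_le_trans _ _ ((1 + IY / IZ) * IZ)); first by rewrite lIZ; lra.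
  rewrite ler_wpM2r ?(ltW IZ0) //.
  have : 1 + IY / IZ <= (1 + IY / IZ) ^+ m.+1 by rewrite ler_eXnr.
  have : 1 <= m.+2%:R :> R by rewrite ler1n.
  move: (m.+2%:R : R) ((1 + IY / IZ) ^+ m.+1) => a b; nra.
have IXm : 0 < IX ^+ m by rewrite exprn_gt0.
(* [l = IZ / IX] is the optimal choice. *)
have := ler_wpM2l (ltW IXm) (lin (IZ / IX) (divr_gt0 IZ0 IX0)).
have -> : IX ^+ m * (m.+1%:R * (IZ / IX) ^+ m * IZ) = m.+1%:R * IZ ^+ m.+1.
  by rewrite expr_div_n exprS; field; rewrite gt_eqF.
have -> : IX ^+ m * (m%:R * (IZ / IX) ^+ m.+1 * IX + IY) =
    m%:R * IZ ^+ m.+1 + IX ^+ m * IY.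
  by rewrite expr_div_n !exprS; field; rewrite !gt_eqF.
rewrite -[m.+1%:R]natr1; move: (IZ ^+ m.+1) (IX ^+ m * IY) (m%:R : R) => a b c;
  lra.
Qed.

(* [|f| <= a ^ (n / n.+1) * al ^ (1 / n.+1)]: interpolates between
   integrability ([n = oo]) and local domination ([n = 0]). *)
Definition interpolated (n : nat) f : Prop := exists a al : R -> R,
  [/\ L1 a, (exists M : R, forall x, `|a x| <= M), measurable_fun setT al,
      loc_dominated al &
      [/\ forall x, 0 <= a x, forall x, 0 <= al x &
          forall x, `|f x| ^+ n.+1 <= a x ^+ n * al x]].

Lemma interpolated0 f : interpolated 0 f -> loc_dominated f.
Proof.
move=> [a [al [_ _ _ LDal [_ al0 fal]]]]; apply: loc_dominated_le LDal => x.
by have := fal x; rewrite expr0 mul1r expr1 (ger0_norm (al0 x)).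
Qed.

(** After squaring, this is the product of the two hypotheses followed by p q <= (p + q)^2 with
    [p = a * be] and [q = al * b]. The sum p + q, unlike a square root of p q, integrates to
    convolutions. *)
Lemma interpolated_mul (m : nat) (A B a b al be : R) :
  0 <= A -> 0 <= B -> 0 <= a -> 0 <= b -> 0 <= al -> 0 <= be ->
  A ^+ m.*2.+2 <= a ^+ m.*2.+1 * al -> B ^+ m.*2.+2 <= b ^+ m.*2.+1 * be ->
  (A * B) ^+ m.+1 <= (a * b) ^+ m * (a * be + al * b).
Proof.
move=> A0 B0 a0 b0 al0 be0 hA hB.
rewrite -ler_sqr ?nnegrE ?exprn_ge0 ?mulr_ge0 ?addr_ge0 ?exprn_ge0 ?mulr_ge0 //.
rewrite -exprM muln2 doubleS exprMn.
apply: le_trans (ler_pM (exprn_ge0 _ A0) (exprn_ge0 _ B0) hA hB) _.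
have -> : a ^+ m.*2.+1 * al * (b ^+ m.*2.+1 * be) =
   ((a * b) ^+ m) ^+ 2 * ((a * be) * (al * b)).
  by rewrite -exprM muln2 !exprS exprMn; ring.
rewrite [leRHS]exprMn ler_wpM2l ?sqr_ge0 //.
have := mulr_ge0 a0 be0; have := mulr_ge0 al0 b0.
by move: (a * be) (al * b) => p q; nra.
Qed.

(** One convolution halves the exponent from [m.*2.+2] to [m.+1]: [interpolated_mul] bounds the
    integrand pointwise and the Hoelder inequality integrates the bound. *)
Lemma interpolated_conv (m : nat) f : L1 f -> (exists M : R, forall x, `|f x|
  <= M) ->
  interpolated m.*2.+1 f -> interpolated m (conv f f).
Proof.
move=> L1f [M fM] [a [al [L1a [Ma aM] mal LDal [a0 al0 fal]]]].
have mf := L1_measurable L1f; have ma := L1_measurable L1a.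
have L1al : L1 al.
  have [H [L1H _ alH]] := LDal; apply: L1_le L1H => // x.
  have := alH x 0; rewrite addr0 normr0 ler01 => /(_ isT) /le_trans; apply.
  exact: ler_norm.
have [Mal alM] := loc_dominated_bounded LDal.
have L1nf := L1_norm L1f; have mnf := L1_measurable L1nf.
(* [al] comes first because local domination passes through the first factor. The 2 accounts for the
   two cross terms, equal by commutativity. *)
exists (conv a a), (fun x => 2 * conv al a x); split.
- exact: L1_conv.
- by exists (Ma * \int[mu]_y `|a y|) => x; exact: conv_bounded.
- by apply: measurable_funM => //; exact: measurable_conv.
- by apply: loc_dominated_scale; exact: loc_dominated_conv.
split.
- by move=> x; apply: Rintegral_ge0 => y _; rewrite mulr_ge0.
- by move=> x; rewrite mulr_ge0 //; apply: Rintegral_ge0 => y _;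
    rewrite mulr_ge0.
move=> x.
have fM' y : `| `|f y| | <= M by rewrite normr_id.
have le_f : `|conv f f x| <= conv (fun y => `|f y|) (fun y => `|f y|) x.
  exact: (norm_conv_le mf mf mnf fM' L1nf).
apply: (@le_trans _ _ (conv (fun y => `|f y|) (fun y => `|f y|) x ^+ m.+1)).
  by rewrite lerXn2r ?nnegrE // (le_trans _ le_f).
have -> : 2 * conv al a x = \int[mu]_y (a (x - y) * al y + al (x - y) * a y).
  rewrite RintegralD //; [|exact: L1_conv_integrand aM L1al|exact:
    L1_conv_integrand alM L1a].
  rewrite -/(conv a al x) -/(conv al a x) (conv_comm ma mal); ring.
apply: Rintegral_geometric_mean_le.
- exact: L1_conv_integrand aM L1a.
- by apply: L1_add; [exact: L1_conv_integrand aM L1al|exact: L1_conv_integrand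
    alM L1a].
- exact: (L1_conv_integrand x mnf fM' L1nf).
- by move=> y; rewrite mulr_ge0.
- by move=> y; rewrite addr_ge0 ?mulr_ge0.
- by move=> y; rewrite mulr_ge0.
- by move=> y; apply: interpolated_mul.
Qed.

End local_domination.

(** * The weight 1 + |x|^eps and the majorant 1 / (1 + x^2) *)

Section weights.
Context {R : realType}.
Local Notation mu := (@lebesgue_measure R).
Local Notation L1 f := (mu.-integrable setT (EFin \o f)).
Implicit Types (f g h : R -> R) (eps x y : R).

(** Away from 0 the power is differentiable; at 0 the radius e^(1/eps) works. *)
Lemma continuous_norm_powR eps : 0 < eps -> continuous (fun x : R => `|x| `^
  eps).
Proof.
move=> eps0 x; have [->|x0] := eqVneq x 0.
  apply/cvgrPdist_le => e e0; near=> y.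
  rewrite normr0 powR0 ?gt_eqF // sub0r normrN ger0_norm ?powR_ge0 //.
  have -> : e = (e `^ eps^-1) `^ eps by rewrite -powRrM mulVf ?gt_eqF // powRr1
    // ltW.
  apply: ge0_ler_powR; rewrite ?nnegrE ?powR_ge0 ?(ltW eps0) //.
  near: y; have /cvgrPdist_le/(_ _ (powR_gt0 eps^-1 e0)) := @cvg_id _ (nbhs (0
    : R)).
  by apply: filterS => z; rewrite sub0r normrN.
apply: (@continuous_comp R R R (fun z => `|z|) (fun z => z `^ eps));
  first exact: norm_continuous.
apply: differentiable_continuous; apply/derivable1_diffP/derivable_powR.
by rewrite in_itv /= andbT normr_gt0.
Unshelve. all: by end_near. Qed.

Definition weight eps x : R := 1 + `|x| `^ eps.

Lemma weight_ge1 eps x : 1 <= weight eps x.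
Proof. by rewrite /weight lerDl powR_ge0. Qed.

Lemma weight_ge0 eps x : 0 <= weight eps x.
Proof. exact: le_trans ler01 (weight_ge1 _ _). Qed.

Lemma continuous_weight eps : 0 < eps -> continuous (weight eps).
Proof.
by move=> eps0 x; apply: cvgD; [exact: cvg_cst|exact: continuous_norm_powR].
Qed.

(** If |x| <= |y| then |x + y| <= 2 |y|; the other case is symmetric. *)
Lemma weightD eps x y : 0 < eps ->
  weight eps (x + y) <= 2 `^ eps * (weight eps x + weight eps y).
Proof.
move=> eps0; have C1 : 1 <= 2 `^ eps :> R.
  have two1 : 1 <= 2 :> R by rewrite ler1n.
  by have := ler_powR two1 (ltW eps0); rewrite powRr0.
wlog xy : x y / `|x| <= `|y|.
  by move=> W; have [/W//|/ltW/W] := leP `|x| `|y|;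
    rewrite addrC [_ + weight _ y]addrC.
have : `|x + y| `^ eps <= 2 `^ eps * `|y| `^ eps.
  rewrite -powRM //; apply: ge0_ler_powR;
    rewrite ?nnegrE ?mulr_ge0 ?(ltW eps0) //.
  by rewrite (le_trans (ler_normD _ _)) // mulr2n mulrDl mul1r lerD.
rewrite /weight; have := powR_ge0 `|x| eps; have := powR_ge0 `|y| eps.
by move: (`|x| `^ eps) (`|y| `^ eps) (`|x + y| `^ eps) (2 `^ eps) C1 => a b c
  d; nra.
Qed.

Lemma weightM eps x y : 0 < eps ->
  weight eps (x + y) <= 2 * 2 `^ eps * (weight eps x * weight eps y).
Proof.
move=> eps0; apply: le_trans (weightD x y eps0) _.
rewrite [2 * _]mulrC -mulrA ler_wpM2l ?powR_ge0 //.
have := weight_ge1 eps x; have := weight_ge1 eps y.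
by move: (weight eps x) (weight eps y) => a b; nra.
Qed.

(** However small [eps] is, a high power of the weight beats 1 + x^2: for |x| > 1, x^2 <= |x|^(eps
    n), and for |x| <= 1 the weight is at least 1. *)
Lemma weightX eps (n : nat) x : 0 < eps -> 2 <= eps * n%:R ->
  1 + x ^+ 2 <= 2 * weight eps x ^+ n.
Proof.
move=> eps0 n2; have w1 := exprn_ege1 n (weight_ge1 eps x).
have [x1|x1] := leP `|x| 1.
  have : x ^+ 2 <= 1 by rewrite -real_normK ?num_real // expr_le1.
  lra.
have : x ^+ 2 <= weight eps x ^+ n.
  apply: (@le_trans _ _ ((`|x| `^ eps) ^+ n)); last first.
    by rewrite lerXn2r ?nnegrE ?powR_ge0 ?weight_ge0 // /weight lerDr.
  rewrite -(powR_mulrn n (powR_ge0 _ _)) -powRrM -real_normK ?num_real //.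
  by rewrite -(powR_mulrn 2 (normr_ge0 x)) ler_powR // ltW.
lra.
Qed.

Lemma L1_oneDsqrV : L1 (fun x => (oneDsqr x)^-1).
Proof.
have mu1 : measurable_fun setT (fun x : R => (oneDsqr x)^-1).
  by apply: continuous_measurable_fun => x; exact: continuous_oneDsqrV.
apply/integrableP; split; first exact/measurable_EFinP.
under eq_integral do rewrite /= ger0_norm ?invr_ge0 //.
pose A := `[0, +oo[%classic : set (measurableTypeR R).
have mA : measurable A by exact: measurable_itv.
have m1E : measurable_fun setT (fun x : R => (oneDsqr x)^-1%:E) by
  exact/measurable_EFinP.
have half : (\int[mu]_(x in A) (oneDsqr x)^-1%:E < +oo)%E.
  by rewrite integral0y_oneDsqr ltry.
have mAc : measurable (~` A) by exact: measurableC.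
have dA : [disjoint A & ~` A] by exact/disj_setPCl.
have := @ge0_integral_setU _ (measurableTypeR R) R mu A (~` A) mA mAc
  (fun x => (oneDsqr x)^-1%:E).
rewrite setUv => ->//.
rewrite lte_add_pinfty //.
(* The negative half-line is reflected onto the positive one; the endpoint [- 0] has the shape
   required by the substitution rule. *)
apply: (@le_lt_trans _ _ (\int[mu]_(x in `]-oo, (- 0)%R]) (oneDsqr x)^-1%:E)%E).
  apply: ge0_subset_integral => //.
  - exact: measurable_funTS.
  - move=> x; rewrite /A /= !in_itv /= oppr0 andbT => /negP.
    by rewrite -ltNge => /ltW.
rewrite (@ge0_integration_by_substitutionNy R (fun x => (oneDsqr x)^-1) 0).
- apply: le_lt_trans half; rewrite le_eqVlt; apply/orP; left; apply/eqP.
  by apply: eq_integral => x _; rewrite /= /oneDsqr sqrrN.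
- by apply: continuous_subspaceT => x; exact: continuous_oneDsqrV.
- by move=> x _; rewrite invr_ge0.
Qed.

(** The constant 3 comes from 1 + x^2 <= 3 (1 + (x + t)^2) for |t| <= 1, since 2 (x + t)^2 + 2 t^2 -
    x^2 = (x + 2 t)^2. *)
Lemma loc_dominated_oneDsqrV : loc_dominated (fun x : R => (oneDsqr x)^-1).
Proof.
exists (fun x => 3 * (oneDsqr x)^-1); split.
- exact: L1_scale L1_oneDsqrV.
- exists 3 => x; rewrite normrM ger0_norm // ger0_norm;
    last by rewrite invr_ge0.
  by rewrite ler_piMr // oneDsqrV_le1.
move=> x t t1; rewrite ger0_norm ?invr_ge0 //.
rewrite -[3]invrK -invfM lef_pV2 ?posrE ?mulr_gt0 ?invr_gt0 //.
rewrite ler_pdivrMl // /oneDsqr.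
have : t ^+ 2 <= 1 by rewrite -real_normK ?num_real // expr_le1.
have := sqr_ge0 (x + 2 * t); have := sqr_ge0 x; nra.
Qed.

(** By [weightD] the weight falls on one factor at a time. The unweighted factor stands first, so
    that its bound or its local domination carries over to the convolution. *)
Lemma weight_conv_le eps g h (M M' x : R) : 0 < eps ->
  L1 g -> (forall y, `|g y| <= M) -> L1 h -> (forall y, `|h y| <= M') ->
  L1 (fun y => weight eps y * g y) -> L1 (fun y => weight eps y * h y) ->
  `|weight eps x * conv g h x| <=
  2 `^ eps * (conv (fun y => `|h y|) (fun y => `|weight eps y * g y|) x +
              conv (fun y => `|g y|) (fun y => `|weight eps y * h y|) x).
Proof.
move=> eps0 L1g gM L1h hM L1wg L1wh.
have L1ng := L1_norm L1g; have L1nh := L1_norm L1h.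
have L1nwg := L1_norm L1wg; have L1nwh := L1_norm L1wh.
have mg := L1_measurable L1g; have mh := L1_measurable L1h.
have mng := L1_measurable L1ng; have mnh := L1_measurable L1nh.
have mnwg := L1_measurable L1nwg; have mnwh := L1_measurable L1nwh.
have ngM y : `| `|g y| | <= M by rewrite normr_id.
have nhM y : `| `|h y| | <= M' by rewrite normr_id.
rewrite normrM (ger0_norm (weight_ge0 _ _)).
apply: (@le_trans _ _ (weight eps x * conv (fun y => `|g y|) (fun y => `|h y|)
  x)).
  by rewrite ler_wpM2l ?weight_ge0 //; exact: (norm_conv_le mg mh mng ngM L1nh).
rewrite (conv_comm mnh mnwg).
have i1 : L1 (fun y => `|weight eps (x - y) * g (x - y)| * `|h y|).
  have := integrable_subl x (L1_conv_integrand x mnh nhM L1nwg).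
  rewrite (_ : (fun y => _) = (fun y => `|weight eps (x - y) * g (x - y)| * `|h
    y|)) //.
  by apply/funext => y; rewrite subKr mulrC.
have i2 := L1_conv_integrand x mng ngM L1nwh.
have i0 := L1_conv_integrand x mng ngM L1nh.
rewrite /Defs.conv -RintegralZl // -RintegralD // -RintegralZl //;
  last exact: L1_add.
apply: le_Rintegral => //; [exact: L1_scale|by apply: L1_scale; exact: L1_add|].
move=> y _; rewrite !normrM !(ger0_norm (weight_ge0 _ _)).
have := weightD (x - y) y eps0; rewrite subrK.
have := mulr_ge0 (normr_ge0 (g (x - y))) (normr_ge0 (h y)).
move=> gh0 /(ler_wpM2r gh0) /le_trans H; apply: H.
by rewrite le_eqVlt; apply/orP; left; apply/eqP; ring.
Qed.

End weights.

(** * Convolution powers and how they reach local domination *)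

Section convolution_powers.
Context {R : realType}.
Local Notation mu := (@lebesgue_measure R).
Local Notation L1 f := (mu.-integrable setT (EFin \o f)).
Implicit Types (f : R -> R) (eps : R).

Lemma conv_powS f n : (0 < n)%N -> conv_pow f n.+1 = conv (conv_pow f n) f.
Proof. by case: n. Qed.

Lemma L1_conv_pow f n : L1 f -> L1 (conv_pow f n).
Proof. by move=> L1f; elim: n => [//|[//|n] IH]; exact: L1_conv. Qed.

Lemma measurable_weight eps : 0 < eps -> measurable_fun setT (weight eps : R ->
  R).
Proof. by move=> eps0; apply: continuous_measurable_fun;
  exact: continuous_weight. Qed.

Lemma L1_weight_conv_pow f eps n : 0 < eps -> L1 f ->
  L1 (fun x => weight eps x * f x) -> L1 (fun x => weight eps x * conv_pow f n
    x).
Proof.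
move=> eps0 L1f L1wf; elim: n => [//|[//|n] IH].
apply: (@L1_conv_weight _ (weight eps) (2 * 2 `^ eps)) => //.
- exact: measurable_weight.
- exact: weight_ge0.
- by move=> x y; exact: weightM.
- exact: L1_measurable (L1_conv_pow n.+1 L1f).
- exact: L1_measurable.
Qed.

(** Induction on [b] by associativity, which holds pointwise thanks to the bound on
    [conv_pow f a]. *)
Lemma conv_powD f (a b : nat) (M : R) : L1 f -> (0 < a)%N -> (0 < b)%N ->
  (forall x, `|conv_pow f a x| <= M) ->
  conv_pow f (a + b) = conv (conv_pow f a) (conv_pow f b).
Proof.
move=> L1f a0 + faM; elim: b => [//|[_ _|b IH _]];
  first by rewrite addn1 conv_powS.
rewrite addnS conv_powS ?addn_gt0 ?a0 // IH // [in RHS]conv_powS //.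
have L1fa := L1_conv_pow a L1f.
by rewrite (conv_assoc (L1_measurable L1fa) faM (L1_conv_pow b.+1 L1f) L1f).
Qed.

(** One more convolution turns the almost everywhere bound at [k0] into a bound everywhere, whence
    the strict inequality [k0 < n]. *)
Lemma conv_pow_bounded f (k0 : nat) : L1 f -> (0 < k0)%N ->
  (exists M : R, {ae mu, forall x, `|conv_pow f k0 x| <= M}) ->
  forall n, (k0 < n)%N -> exists M : R, forall x, `|conv_pow f n x| <= M.
Proof.
move=> L1f k00 [M faM]; elim=> [//|n IH]; rewrite ltnS leq_eqVlt.
have L1fn := L1_conv_pow _ L1f => /predU1P[<-|k0n].
  exists (`|M| * \int[mu]_y `|f y|) => x; rewrite conv_powS //.
  apply: conv_ae_bounded => //; first exact: L1_measurable (L1fn _).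
  apply: filterS faM => [|y fy]; first exact: (ae_filter_ringOfSetsType mu).
  exact: le_trans fy (ler_norm _).
have [M' fM'] := IH k0n; exists (M' * \int[mu]_y `|f y|) => x.
rewrite conv_powS ?(ltn_trans k00) //; apply: conv_bounded => //.
exact: L1_measurable (L1fn _).
Qed.

(** This is 2^j - 1, in the recursive form that matches [interpolated_conv]. *)
Fixpoint pow2_pred (j : nat) : nat :=
  if j is i.+1 then (pow2_pred i).*2.+1 else 0%N.

Lemma leq_pow2_pred j : (j <= pow2_pred j)%N.
Proof.
elim: j => //= j IH; rewrite ltnS (leq_trans IH) //.
by rewrite -addnn leq_addr.
Qed.

(** Convolving [conv_pow f n] with itself doubles [n] and lowers [j] by one; [j = 0] is local
    domination. *)
Lemma interpolated_conv_pow f (q : nat) : L1 f -> (0 < q)%N ->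
  (forall n, (q <= n)%N -> exists M : R, forall x, `|conv_pow f n x| <= M) ->
  forall j n, (q <= n)%N -> interpolated (pow2_pred j) (conv_pow f n) ->
  exists2 K, (q <= K)%N & loc_dominated (conv_pow f K).
Proof.
move=> L1f q0 bf; elim=> [|j IH] n qn fn; first by exists n => //;
  exact: interpolated0.
have [M fM] := bf n qn; have n0 : (0 < n)%N := leq_trans q0 qn.
apply: (IH (n + n)%N); first exact: leq_trans (leq_addr _ _).
rewrite (conv_powD L1f n0 n0 fM); apply: interpolated_conv => //.
  exact: L1_conv_pow.
by exists M.
Qed.

(** With [n = pow2_pred j] large, [weightX] gives (1 + x^2) |f|^(n+1) <= 2 M (w |f|)^n, where w is
    the weight. A factor [c] in front of w |f| absorbs 2 M. *)
Lemma interpolated_weight f eps : 0 < eps -> L1 f ->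
  (exists M : R, forall x, `|f x| <= M) ->
  L1 (fun x => weight eps x * f x) ->
  (exists M : R, forall x, `|weight eps x * f x| <= M) ->
  exists j, interpolated (pow2_pred j) f.
Proof.
move=> eps0 L1f [M fM] L1wf [M' wfM'].
have M0 : 0 <= M := le_trans (normr_ge0 _) (fM 0).
(* Since [j <= pow2_pred j], this choice ensures [eps * n >= 2]; the successor makes [n]
   positive. *)
pose j := (Num.bound (2 / eps)).+1; exists j.
set n := pow2_pred j; have n0 : (0 < n)%N := leq_trans (ltn0Sn _)
  (leq_pow2_pred j).
have n2 : 2 <= eps * n%:R.
  rewrite -ler_pdivrMl // mulrC; apply: ltW.
  apply: lt_le_trans (archi_boundP _) _; first by rewrite divr_ge0 // ltW.
  by rewrite ler_nat (leq_trans _ (leq_pow2_pred j)).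
(* Chosen so that 2 M <= c <= c^n. *)
pose c := 1 + 2 * M; have c1 : 1 <= c by rewrite lerDl mulr_ge0.
exists (fun x => c * `|weight eps x * f x|), (fun x => (oneDsqr x)^-1); split.
- exact/L1_scale/L1_norm.
- exists (c * M') => x; rewrite normrM normr_id (ger0_norm (le_trans ler01 c1)).
  by rewrite ler_wpM2l // (le_trans ler01 c1).
- by apply: continuous_measurable_fun => x; exact: continuous_oneDsqrV.
- exact: loc_dominated_oneDsqrV.
split.
- by move=> x; rewrite mulr_ge0 // (le_trans ler01 c1).
- by move=> x; rewrite invr_ge0.
move=> x; rewrite ler_pdivlMr // normrM (ger0_norm (weight_ge0 _ _)) !exprMn
  exprS.
have fn0 : 0 <= `|f x| ^+ n by exact: exprn_ge0.
have wn := weightX x eps0 n2.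
have cn : c <= c ^+ n by rewrite ler_eXnr.
have wn0 : 0 <= weight eps x ^+ n by rewrite exprn_ge0 // weight_ge0.
rewrite -mulrA [leLHS]mulrCA [leRHS]mulrA [leRHS]mulrC ler_wpM2l //.
apply: (@le_trans _ _ (M * (2 * weight eps x ^+ n))).
  by apply: ler_pM => //; exact: le_trans ler01 (oneDsqr_ge1 _).
rewrite mulrA ler_wpM2r // (le_trans _ cn) // /c mulrC.
by rewrite lerDr.
Qed.

End convolution_powers.

(** * Choice of the indices and conclusion *)

Theorem theorem1p1 (R : realType) (f : R -> R)
  (hf : (@lebesgue_measure R).-integrable setT (EFin \o f))
  (hinf : exists k0 : nat, (0 < k0)%N /\
     exists M : R, {ae @lebesgue_measure R, forall x, `|conv_pow f k0 x| <= M})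
  (eps : R) (heps : 0 < eps)
  (hmom : (\int[@lebesgue_measure R]_x ((`|x| `^ eps * `|f x|)%:E) < +oo)%E) :
  exists k1 : nat, (0 < k1)%N /\ forall k : nat, (k1 <= k)%N ->
    let g := fun x => (1 + `|x| `^ eps) * conv_pow f k x in
    (exists M : R, forall x, `|g x| <= M) /\ continuous g /\ dRi g /\
    ((exists M : R, forall x, `|conv_pow f k x| <= M) /\
     continuous (conv_pow f k) /\ dRi (conv_pow f k)).
Proof.
have [k0 [k00 fk0M]] := hinf.
have L1wf : (@lebesgue_measure R).-integrable setT
    (EFin \o (fun x => weight eps x * f x)).
  have mf := L1_measurable hf.
  have L1mom : (@lebesgue_measure R).-integrable setT
      (EFin \o (fun x => `|x| `^ eps * `|f x|)).
    apply/integrableP; split; last first.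
      under eq_integral do rewrite /= ger0_norm ?mulr_ge0 ?powR_ge0 //.
      exact: hmom.
    apply/measurable_EFinP; apply: measurable_funM;
      last exact: measurableT_comp.
    by apply: continuous_measurable_fun; exact: continuous_norm_powR.
  apply: L1_le (L1_add (L1_norm hf) L1mom) => [|x].
    by apply: measurable_funM => //; exact: measurable_weight.
  rewrite normrM (ger0_norm (weight_ge0 _ _)) /weight mulrDl mul1r.
  exact: ler_norm.
have bf n : (k0.+1 <= n)%N -> exists M : R, forall x, `|conv_pow f n x| <= M.
  exact: conv_pow_bounded fk0M n.
have L1w n := L1_weight_conv_pow n heps hf L1wf.
have L1n n := L1_conv_pow n hf.
have wsplit a b : (k0.+1 <= a)%N -> (k0.+1 <= b)%N -> forall x,
    `|weight eps x * conv_pow f (a + b) x| <=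
    2 `^ eps * (conv (fun y => `|conv_pow f b y|)
                  (fun y => `|weight eps y * conv_pow f a y|) x +
                conv (fun y => `|conv_pow f a y|)
                  (fun y => `|weight eps y * conv_pow f b y|) x).
  move=> ka kb x; have [Ma faM] := bf a ka; have [Mb fbM] := bf b kb.
  rewrite (conv_powD hf (leq_trans (ltn0Sn _) ka) (leq_trans (ltn0Sn _) kb)
    faM).
  exact: (weight_conv_le x heps (L1n a) faM (L1n b) fbM (L1w a) (L1w b)).
(* Both halves of [q] are indices of bounded powers, so [wsplit] bounds the weighted power of index
   [q]. *)
pose q := (k0.+1 + k0.+1)%N.
have bwq : exists M : R, forall x, `|weight eps x * conv_pow f q x| <= M.
  have [M fM] := bf k0.+1 (leqnn _).
  have nfM y : `| `|conv_pow f k0.+1 y| | <= M by rewrite normr_id.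
  have mnf := L1_measurable (L1_norm (L1n k0.+1)).
  exists (2 `^ eps * (M * \int[@lebesgue_measure R]_y
      `| `|weight eps y * conv_pow f k0.+1 y| | +
    M * \int[@lebesgue_measure R]_y
      `| `|weight eps y * conv_pow f k0.+1 y| |)) => x.
  apply: le_trans (wsplit _ _ (leqnn _) (leqnn _) x) _.
  rewrite ler_wpM2l ?powR_ge0 // lerD //;
    exact: le_trans (ler_norm _) (conv_bounded x mnf nfM (L1_norm (L1w k0.+1))).
have kq : (k0.+1 <= q)%N by rewrite leq_addr.
have [j qj] := interpolated_weight heps (L1n q) (bf q kq) (L1w q) bwq.
have [K kK LDK] := interpolated_conv_pow hf (ltn0Sn k0) bf kq qj.
(* Convolving the power of index [K] with that of index [n - K] preserves local domination; [n > K]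
   makes the second index positive. *)
have LDn n : (K < n)%N -> loc_dominated (conv_pow f n).
  move=> Kn; have [M KM] := bf K kK; rewrite -(subnKC (ltnW Kn)).
  rewrite (conv_powD hf (leq_trans (ltn0Sn _) kK) _ KM) ?subn_gt0 //.
  exact: loc_dominated_conv (L1_measurable (L1n K)) LDK (L1n _).
(* From here on [k] splits as [K.+1 + b] with [b > K]. Both powers are locally dominated, as
   [wsplit] requires of whichever factor is left unweighted. *)
exists (K.+1 + K.+1)%N; split=> // k Kk; set g := fun x => _.
pose b := (k - K.+1)%N; have Kb : (K < b)%N by rewrite leq_subRL // (leq_trans
  _ Kk) ?leq_addr.
have kE : k = (K.+1 + b)%N by rewrite subnKC // (leq_trans _ Kk) ?leq_addr.
have k0b : (k0.+1 <= b)%N := leq_trans kK (ltnW Kb).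
have k0K : (k0.+1 <= K.+1)%N := leq_trans kK (leqnSn K).
have LDg : loc_dominated g.
  pose G x := conv (fun y => `|conv_pow f b y|)
                  (fun y => `|weight eps y * conv_pow f K.+1 y|) x +
                conv (fun y => `|conv_pow f K.+1 y|)
                  (fun y => `|weight eps y * conv_pow f b y|) x.
  apply: (@loc_dominated_le _ _ (fun x => 2 `^ eps * G x)).
    by move=> x; rewrite (le_trans _ (ler_norm _)) // /g kE; exact: wsplit.
  apply: loc_dominated_scale; apply: loc_dominated_add.
    apply: loc_dominated_conv (L1_norm (L1w _)).
      exact: L1_measurable (L1_norm (L1n _)).
    exact: loc_dominated_norm (LDn b Kb).
  apply: loc_dominated_conv (L1_norm (L1w _)).
    exact: L1_measurable (L1_norm (L1n _)).
  exact: loc_dominated_norm (LDn K.+1 (ltnSn K)).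
have LDk : loc_dominated (conv_pow f k).
  by apply: LDn; rewrite (leq_trans _ Kk) // leq_addr.
have ck : continuous (conv_pow f k).
  have [M fM] := bf K.+1 k0K.
  rewrite kE (conv_powD hf _ _ fM) ?(leq_trans (ltn0Sn _) Kb) //.
  exact: continuous_conv (L1n _) fM (L1n _).
have cg : continuous g.
  by move=> x; apply: cvgM; [exact: continuous_weight|exact: ck].
split; first exact: loc_dominated_bounded.
split=> //; split; first exact: continuous_loc_dominated_dRi.
split; first exact: loc_dominated_bounded.
by split=> //; exact: continuous_loc_dominated_dRi.
Qed.
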